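(* Let $G$ be a finitely generated acylindrically hyperbolic group and let $H$ be a subgroup of $G$. If $H$ contains a generalized loxodromic element of $G$, then the relative growth rate of $H$ exists with respect to every finite generating set of $G$; that is, for every finite generating set $X$ of $G$ the limit $\lim_{n\to\infty}\sqrt[n]{\beta_H^X(n)}$ exists.
   Context: For a group $G$ with finite generating set $X$, $|g|_X$ denotes word length with respect to $X\cup X^{-1}$. For a subgroup $H\le G$ (not necessarily finitely generated) and $n\in\mathbb{N}$, $B_H^X(n)=\{h\in H : |h|_X\le n\}$ and $\beta_H^X(n)=|B_H^X(n)|$. The relative (exponential) growth rate of $H$ with respect to $X$ is said to exist if $\lim_{n\to\infty}\sqrt[n]{\beta_H^X(n)}$ exists. A hyperbolic space is a geodesic metric space that is Gromov hyperbolic. An action of a group $G$ by isometries on a metric space $(\Omega,d)$ is acylindrical if for every $\varepsilon>0$ there are constants $R,N>0$ such that for all $x,y\in\Omega$ with $d(x,y)\ge R$ there are at most $N$ elements $g\in G$ with $d(x,gx)\le\varepsilon$ and $d(y,gy)\le\varepsilon$. For an action on a hyperbolic space $\Omega$, an element $g\in G$ is loxodromic if $\mathbb{Z}\to\Omega$, $n\mapsto g^n x$, is a quasigeodesic (i.e. a quasi-isometric embedding) for some (equivalently any) $x\in\Omega$. Two loxodromic elements are independent if their fixed point sets in the Gromov boundary $\partial\Omega$ are disjoint. An acylindrical action of $G$ on a hyperbolic space is elementary if $G$ has bounded orbits, or $G$ is virtually cyclic and contains a loxodromic element; otherwise it is non-elementary (equivalently, $G$ contains infinitely many independent loxodromic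 elements). $G$ is acylindrically hyperbolic if it admits a non-elementary acylindrical action on a hyperbolic space. An element $g\in G$ is generalized loxodromic if there is an acylindrical action of $G$ on a hyperbolic space for which $g$ is loxodromic. *)

(* Defs.v *)
From mathcomp Require Import all_boot all_order all_algebra.
From mathcomp Require Import finmap.
From mathcomp Require Import all_classical all_reals all_analysis.

Set Implicit Arguments.
Unset Strict Implicit.
Unset Printing Implicit Defensive.

Import Order.TTheory GRing.Theory Num.Theory.
Import numFieldNormedType.Exports.

Local Open Scope classical_set_scope.
Local Open Scope card_scope.
Local Open Scope ring_scope.

Section Groups.
Variable G : groupType.
Implicit Types (X H : set G) (g : G) (w : seq G) (n : nat).

Definition subgroup H : Prop := group_closed (mem H).

Definition word_over X w : Prop := {in w, forall x, X x \/ X x^-1%g}.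

Definition represented_by_word X g n : Prop :=
  exists w, [/\ word_over X w, size w = n & (\prod_(x <- w) x)%g = g].

Definition generates X : Prop := forall g, exists n, represented_by_word X g n.

Definition finite_generating_set X : Prop := finite_set X /\ generates X.

Definition finitely_generated : Prop := exists X, finite_generating_set X.

(* The default value 0 is only taken when g is not a product of elements of
   X and their inverses, hence never when X generates G. *)
Definition word_length X g : nat :=
  xget 0%N [set n | represented_by_word X g n /\
                    forall m, represented_by_word X g m -> (n <= m)%N].

Definition relative_ball X H n : set G :=
  [set h | H h /\ (word_length X h <= n)%N].

(* fset_set sends an infinite set to the empty one; when X is a finite
   generating set every ball is finite. *)
Definition relative_growth X H n : nat :=
  (#|` fset_set (relative_ball X H n)|)%fset.

Definition relative_growth_rate_exists (R : realType) X H : Prop :=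
  cvgn (fun n : nat => ((relative_growth X H n)%:R : R) `^ (n%:R)^-1).

Definition expgz g (n : int) : G :=
  match n with Posz m => (g ^+ m)%g | Negz m => (g ^- m.+1)%g end.

Definition cyclic_subgroup g : set G := range (expgz g).

Definition left_coset H g : set G := [set (g * h)%g | h in H].

Definition finite_index H : Prop := finite_set (range (left_coset H)).

Definition virtually_cyclic : Prop :=
  exists g, finite_index (cyclic_subgroup g).

End Groups.

Arguments finitely_generated : clear implicits.
Arguments virtually_cyclic : clear implicits.

Section HyperbolicSpaces.
Variables (R : realType) (T : metricType R).
Implicit Types x y z w : T.

Definition geodesic_space : Prop :=
  forall x y, exists c : R -> T,
    [/\ c 0 = x, c (mdist x y) = y &
        {in `[0, mdist x y] &, forall s t, mdist (c s) (c t) = `|s - t|}].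

Definition gromov_product w x y : R :=
  (mdist x w + mdist y w - mdist x y) / 2.

Definition gromov_hyperbolic : Prop :=
  exists delta : R, forall w x y z,
    Num.min (gromov_product w x y) (gromov_product w y z) - delta
      <= gromov_product w x z.

(* metricType allows the empty space, which is excluded here. *)
Definition hyperbolic_space : Prop :=
  [/\ [set: T] !=set0, geodesic_space & gromov_hyperbolic].

End HyperbolicSpaces.

Arguments geodesic_space {R} T.
Arguments gromov_hyperbolic {R} T.
Arguments hyperbolic_space {R} T.

Section Actions.
Variables (R : realType) (G : groupType) (T : metricType R).
Variable a : G -> T -> T.

Definition isometric_action : Prop :=
  [/\ forall x, a 1%g x = x,
      forall g h x, a (g * h)%g x = a g (a h x) &
      forall g x y, mdist (a g x) (a g y) = mdist x y].

Definition acylindrical : Prop :=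
  forall eps : R, 0 < eps -> exists (r : R) (N : nat),
    [/\ 0 < r, (0 < N)%N &
        forall x y, r <= mdist x y ->
          [set g | mdist x (a g x) <= eps /\ mdist y (a g y) <= eps] #<= `I_N].

Definition quasi_isometric_embedding_int (f : int -> T) : Prop :=
  exists L C : R, [/\ 1 <= L, 0 <= C &
    forall m n : int, L^-1 * `|m - n|%:~R - C <= mdist (f m) (f n)
                      /\ mdist (f m) (f n) <= L * `|m - n|%:~R + C].

Definition loxodromic (g : G) : Prop :=
  exists x : T, quasi_isometric_embedding_int (fun n => a (expgz g n) x).

Definition bounded_orbits : Prop :=
  forall x : T, exists C : R, forall g h, mdist (a g x) (a h x) <= C.

Definition elementary : Prop :=
  bounded_orbits \/ (virtually_cyclic G /\ exists g, loxodromic g).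

Definition acylindrical_hyperbolic_action : Prop :=
  [/\ hyperbolic_space T, isometric_action & acylindrical].

End Actions.

Definition acylindrically_hyperbolic (R : realType) (G : groupType) : Prop :=
  exists (T : metricType R) (a : G -> T -> T),
    acylindrical_hyperbolic_action a /\ ~ elementary a.

Definition generalized_loxodromic (R : realType) (G : groupType) (g : G) :
    Prop :=
  exists (T : metricType R) (a : G -> T -> T),
    acylindrical_hyperbolic_action a /\ loxodromic a g.

(* Main.v *)
Require Import Defs.
From mathcomp Require Import all_boot all_order all_algebra.
From mathcomp Require Import all_classical all_reals all_analysis.
From mathcomp Require Import finmap zify lra.

Set Implicit Arguments.
Unset Strict Implicit.
Unset Printing Implicit Defensive.

Import Order.TTheory GRing.Theory Num.Theory.
Import numFieldNormedType.Exports.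

Local Open Scope classical_set_scope.
Local Open Scope ring_scope.

(** Let g be a generalized loxodromic element of H, let x be a basepoint of a
hyperbolic space on which g is loxodromic, and put l(a) = d(x, a x).  The whole
argument takes place in the group, with the length l: it satisfies the
four-point hyperbolicity inequality, the centralizer-like sets occurring in the
definition of acylindricity are finite of bounded size, and l is bounded by a
multiple of the word length.

Write b(n) for the number of elements of H of word length at most n.  The point
is an inequality b(n)^m <= (k (n + 1))^m b(m (n + c)) with constants c and k:
it says that b is supermultiplicative up to a shift and up to a factor which is
only linear in n.  Fekete's argument then gives the limit of b(n)^(1/n)
(root_cvg_of_supermultiplicative).

To get the inequality, products s1 f s2 f ... sm f are formed with the si in a
large part S of the n-ball of H and a fixed element f of H.  If at every
junction the Gromov product is at most A, while all the factors are long
compared with A, then the points x, s1 x, s1 f x, s1 f s2 x, ... follow a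
quasigeodesic (block_products_straight).  If moreover the lengths of the si
differ by at most 1, the factor s1 can almost be read off from the product:
both s1 x and s1 f x are known up to a bounded error, and acylindricity leaves
boundedly many candidates (block_products_decode).  Hence the number of products
is at least (|S| / N)^m.

Two pigeonhole arguments provide S and f.  Sorting the n-ball by length costs
the factor linear in n.  For the junctions one needs, for every y and z in the
group, an f such that f starts in a direction different from that of y and f^-1
in a direction different from that of z.  Four elements suffice: f starts near
one of the two ends of the axis of g, f^-1 starts near one of them, and all four
combinations occur (exists_pivots).  The combinations with twice the same end
are the conjugates g^n t g^-n, with n positive or negative, where t in H does
not fix the opposite end.  If H has no such t, then H fixes an end of the axis;
in that case elements of H of the same displacement far out on the axis differ
by boundedly many elements, so b grows at most linearly and the inequality is
trivial (moves_end_or_small_growth). *)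

(** * Fekete's argument *)

(** The factor k (n + 1) and the shift c are lost once per factor of a product
of m elements; both are negligible after an n-th root is taken. *)
Definition supermultiplicative_up_to (b : nat -> nat) (c k : nat) : Prop :=
  forall n m, (b n ^ m <= (k * n.+1) ^ m * b (m * (n + c)))%N.

Section Fekete.
Variable R : realType.

Lemma cvg_of_affine_bounds (x : nat -> R) (s : R) :
  (forall e : R, 0 < e -> exists D : R, forall n,
     (s - e) * n%:R - D <= x n <= (s + e) * n%:R + D) ->
  (fun n => n%:R^-1 * x n) @ \oo --> s.
Proof.
move=> H; apply/cvgrPdist_le => e e0.
have [D hD] := H (e / 2) (divr_gt0 e0 (ltr0Sn R 1)).
exists (Num.truncn (`|D| / (e / 2))).+1 => //= n hn.
have n0 : 0 < n%:R :> R by rewrite ltr0n; apply: leq_trans hn.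
have /andP[h1 h2] := hD n.
have hD' : `|D| <= e / 2 * n%:R.
  rewrite -ler_pdivrMl ?divr_gt0 // mulrC; apply: le_trans (ltW (truncnS_gt _)) _.
  by rewrite ler_nat.
have := ler_norm D => D1.
rewrite ler_distlC -(ler_pM2l n0) -[X in _ && X](ler_pM2l n0) !mulrA.
by rewrite divff ?gt_eqF // mul1r; apply/andP; split; lra.
Qed.

(** Linear functions of n contribute nothing to the exponential rate: ln grows
more slowly than any linear function. *)
Lemma ln_affine_bound (e : R) : 0 < e ->
  exists D : R, forall n : nat, ln (n.+1%:R) <= e * n%:R + D.
Proof.
move=> e0; exists (e - ln e) => n.
have p0 : 0 < n.+1%:R :> R by rewrite ltr0n.
have := ln_sublinear (mulr_gt0 e0 p0).
by rewrite lnM ?posrE // -natr1; lra.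
Qed.

(** With y(n) = ln b(n) - ln (k (n + 1)), supermultiplicativity bounds ln b(m)
below by roughly m y(n) / (n + c) for every n, so the limit of ln b(n) / n is
the supremum of the numbers y(n) / (n + c). *)
Lemma root_cvg_of_supermultiplicative (b : nat -> nat) (c k a : nat) :
  (forall n, (0 < b n)%N) -> {homo b : m n / (m <= n)%N} ->
  (forall n, (b n <= a ^ n)%N) -> supermultiplicative_up_to b c k ->
  cvgn (fun n : nat => ((b n)%:R : R) `^ (n%:R)^-1).
Proof.
move=> b0 bmono ba bsup.
(* k and c are replaced by k + 1 and c + 1, so that the logarithm of the first
   is nonnegative and the quotient by n + c + 1 is meaningful. *)
pose x n := ln ((b n)%:R : R).
pose p n : nat := (n + c).+1.
pose y n := x n - (ln k.+1%:R + ln n.+1%:R).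
have bp n : 0 < (b n)%:R :> R by rewrite ltr0n.
have Sp n : 0 < n.+1%:R :> R by rewrite ltr0n.
have pp n : 0 < (p n)%:R :> R by exact: Sp.
have x0 n : 0 <= x n by rewrite ln_ge0 // ler1n.
have xmono m n : (m <= n)%N -> x m <= x n.
  by move=> mn; rewrite ler_ln ?posrE // ler_nat bmono.
have xsup n m : m%:R * y n <= x (m * p n)%N.
  have : (b n ^ m <= (k.+1 * n.+1) ^ m * b (m * p n))%N.
    apply: leq_trans (bsup n m) _; rewrite leq_mul //.
      by case: m => // m; rewrite leq_exp2r // leq_mul.
    by rewrite bmono // leq_mul.
  rewrite -(ler_nat R) natrM !natrX natrM => le_b.
  have kn0 : 0 < k.+1%:R * n.+1%:R :> R by rewrite mulr_gt0.
  have le_ln : ln ((b n)%:R ^+ m : R) <=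
      ln ((k.+1%:R * n.+1%:R) ^+ m * (b (m * p n)%N)%:R : R).
    by rewrite ler_ln ?posrE ?mulr_gt0 ?exprn_gt0.
  move: le_ln; rewrite lnXn // lnM ?posrE ?exprn_gt0 // lnXn // lnM ?posrE //.
  rewrite -[leLHS]mulr_natl -[X in _ <= X + _]mulr_natl => le_ln.
  by rewrite /y mulrBr lerBlDl.
have xle n : x n <= n%:R * ln a.+1%:R.
  rewrite mulr_natl -lnXn // ler_ln ?posrE ?exprn_gt0 // -natrX ler_nat.
  by apply: leq_trans (ba n) _; case: n => // n; rewrite leq_exp2r.
pose v n := y n / (p n)%:R.
have yv n : y n = v n * (p n)%:R by rewrite /v divfK // gt_eqF.
have vub : has_ubound (range v).
  exists (ln a.+1%:R) => _ [n _ <-].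
  rewrite /v ler_pdivrMr //; have := xsup n 1%N; have := xle (p n).
  by rewrite mul1n; lra.
pose s := sup (range v).
have vs n : v n <= s by apply: ub_le_sup => //; exists n.
have lower n m : v n * m%:R - `|v n| * (p n)%:R <= x m.
  have [v0|v0] := leP 0 (v n); last first.
    have := x0 m; have : 0 <= m%:R :> R by []. have := pp n; rewrite (ltr0_norm v0); nra.
  rewrite (ger0_norm v0) -mulrBr.
  have [q r ->] := edivnP m (p n); last rewrite ltn0Sn /= => r_lt.
  apply: le_trans (xmono _ _ (leq_addr r (q * p n)%N)).
  apply: le_trans (xsup n q); rewrite yv mulrCA.
  rewrite ler_wpM2l // natrD natrM.
  by move: r_lt; rewrite -(ltr_nat R); lra.
have xs : (fun n => n%:R^-1 * x n) @ \oo --> s.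
  apply: cvg_of_affine_bounds => e e0.
  have [_ [n _ <-] vn] := sup_adherent e0 (conj (ex_intro _ _ (ex_intro2 _ _ 0%N I erefl)) vub).
  have [D hD] := ln_affine_bound e0.
  pose E := `|s| * c.+1%:R + ln k.+1%:R + `|D|.
  exists (`|v n| * (p n)%:R + E) => m.
  have E0 : 0 <= E by rewrite /E !addr_ge0 // ?mulr_ge0 // ln_ge0 // ler1n.
  have m0 : 0 <= m%:R :> R by [].
  apply/andP; split.
    by have := lower n m; rewrite -/s in vn; nra.
  have : y m <= s * (p m)%:R by rewrite yv ler_wpM2r.
  have := hD m; have := ler_norm D; have : 0 <= `|v n| * (p n)%:R by rewrite mulr_ge0.
  have : s * c.+1%:R <= `|s| * c.+1%:R by rewrite ler_wpM2r // ler_norm.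
  by rewrite /y /p /E -addnS natrD; lra.
apply/cvg_ex; exists (expR s).
rewrite (_ : (fun n => _) = expR \o (fun n => n%:R^-1 * x n)).
  by apply: continuous_cvg => //; exact: continuous_expR.
by apply/funext => n; rewrite /powR gt_eqF.
Qed.

End Fekete.

(** * Counting by fibres *)

Section Counting.
Local Open Scope fset_scope.
Local Open Scope nat_scope.
Variables (T U : choiceType).

Lemma card_fibers_le (A : {fset T}) (phi : T -> U) N :
  (forall a, a \in A -> #|` [fset b in A | phi b == phi a]| <= N) ->
  #|` A| <= N * #|` phi @` A|.
Proof.
move=> fib; rewrite card_fset_sum1 (partition_big_imfset _ phi).
rewrite (card_fset_sum1 (phi @` A)) big_distrr /= big_seq [leqRHS]big_seq.
apply: leq_sum => u /imfsetP[a /= aA ->]; rewrite muln1.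
apply: leq_trans (fib a aA); rewrite card_fset_sum1 big_fset_condE.
by apply: eq_leq; apply: eq_fbigl => x; rewrite !inE.
Qed.

Lemma card_pairs (A : {fset T}) (B : {fset U}) :
  #|` A `*` B| = #|` A| * #|` B|.
Proof.
rewrite card_fset_sum1 big_imfset2 /=.
  rewrite (card_fset_sum1 A) big_distrl /=; apply: eq_bigr => i _.
  by rewrite mul1n card_fset_sum1.
by move=> [x y] [x' y'] _ _ /= [-> ->].
Qed.

End Counting.

Lemma pigeonhole (T : choiceType) (U : finType) (A : {fset T}) (phi : T -> U) :
  (0 < #|` A|)%N ->
  exists u, (#|` A| <= #|U| * #|` [fset a in A | phi a == u]%fset|)%N.
Proof.
rewrite cardfs_gt0 => /fset0Pn[a0 a0A].
have [u eu] := @bigop.eq_bigmax U (fun u => #|` [fset a in A | phi a == u]%fset|)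
                 (introT card_gt0P (ex_intro _ (phi a0) isT)).
exists u; rewrite -eu mulnC.
set N := \max_v _.
apply: leq_trans (@card_fibers_le _ _ A phi N _) _ => [a aA|].
  exact: (@bigop.leq_bigmax _ (fun u => #|` [fset a in A | phi a == u]%fset|) (phi a)).
rewrite leq_mul2l; apply/orP; right.
by rewrite cardE; apply: uniq_leq_size (fset_uniq _) _ => x; rewrite mem_enum.
Qed.

(** * Hyperbolic length functions *)

Section HyperbolicLengths.
Variables (R : realType) (G : groupType).
Implicit Types (l : G -> R) (d : R) (a b c e g p q t y z : G).

(** The Gromov product of a x and b x based at x, when l a is d(x, a x). *)
Definition gprod l a b : R := (l a + l b - l (a^-1 * b)%g) / 2.

Record hyperbolic_length l d : Prop := HyperbolicLength {
  length1 : l 1%g = 0;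
  lengthV : forall a, l a^-1%g = l a;
  lengthM : forall a b, l (a * b)%g <= l a + l b;
  length_hyperbolic : forall a b c,
    Num.min (gprod l a b) (gprod l b c) - d <= gprod l a c }.

(** Acylindricity read on a single orbit: an element h displacing both x and
b x by at most eps satisfies l h <= eps and l (b^-1 h b) <= eps. *)
Definition acylindrical_length l : Prop :=
  forall eps : R, 0 < eps -> exists (r : R) (N : nat),
    forall b, r <= l b -> forall A : {fset G},
      (forall h, h \in A -> l h <= eps /\ l (b^-1 * h * b)%g <= eps) ->
      (#|` A| <= N)%N.

Variables (l : G -> R) (d : R).
Hypothesis hl : hyperbolic_length l d.

Local Notation gp := (gprod l).

Lemma hyperbolicity_ge0 : 0 <= d.
Proof.
have := length_hyperbolic hl 1 1 1.
rewrite /gprod invg1 mulg1 (length1 hl); have -> : (0 + 0 - 0) / 2 = 0 :> R by lra.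
by rewrite minxx; lra.
Qed.

Lemma length_ge0 a : 0 <= l a.
Proof.
have := lengthM hl a a^-1; rewrite mulgV (length1 hl) (lengthV hl); lra.
Qed.

Lemma gprodC a b : gp a b = gp b a.
Proof.
by rewrite /gprod -(lengthV hl (b^-1 * a)%g) invgM invgK [l b + _]addrC.
Qed.

Lemma gprod_ge0 a b : 0 <= gp a b.
Proof.
rewrite /gprod; have := lengthM hl a^-1 b; rewrite (lengthV hl); lra.
Qed.

Lemma gprod_leL a b : gp a b <= l a.
Proof.
rewrite /gprod; have := lengthM hl a (a^-1 * b)%g; rewrite mulVKg.
lra.
Qed.

Lemma gprod_leR a b : gp a b <= l b.
Proof. by rewrite gprodC gprod_leL. Qed.

Lemma gprod_mulr a b : gp a (a * b)%g = l a - gp a^-1 b.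
Proof. by rewrite /gprod mulKg invgK (lengthV hl); lra. Qed.

Lemma lengthM_gprod a b : l (a * b)%g = l a + l b - 2 * gp a^-1 b.
Proof. by rewrite /gprod invgK (lengthV hl); lra. Qed.

Lemma lengthVM_gprod a b : l (a^-1 * b)%g = l a + l b - 2 * gp a b.
Proof. by rewrite /gprod; lra. Qed.

Lemma gprod_tri b a c : gp a b <= gp a c + d \/ gp b c <= gp a c + d.
Proof.
by have := length_hyperbolic hl a b c; rewrite lerBlDr ge_min => /orP.
Qed.

(** The local-to-global principle for one junction.  Seen from x, the points
b x and b q x lie in the same direction, because b is long and the path x, b x,
b q x hardly backtracks; so y diverges from b q x where it diverges from b x. *)
Lemma gprod_step y b q C C' :
  gp y b <= C -> gp b^-1 q <= C' -> C + C' + d < l b -> gp y (b * q)%g <= C + d.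
Proof.
move=> yb bq lb; have := gprod_mulr b q.
by case: (gprod_tri (b * q)%g y b); rewrite ?(gprodC (b * q) b); lra.
Qed.

(** Two points nearly on the way from x to p x, at nearly the same distance from
x, are close to each other. *)
Lemma same_direction_close y y' p C w :
  l y - C <= gp y p -> l y' - C <= gp y' p ->
  l y <= l y' + w -> l y' <= l y + w ->
  l (y^-1 * y')%g <= w + 2 * C + 2 * d.
Proof.
move=> yp y'p le1 le2; rewrite lengthVM_gprod.
by case: (gprod_tri p y y'); rewrite ?(gprodC p); lra.
Qed.

(** * Axes of loxodromic elements *)

(** Powers of g travel along a quasigeodesic line through x.  The growth by at
least 1 at each step makes the length of the powers strictly increasing. *)
Record quasi_axis g C : Prop := QuasiAxis {
  axis_straight : forall m n, gp (g ^- m)%g (g ^+ n)%g <= C;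
  axis_growth : forall n, l (g ^+ n)%g + 1 <= l (g ^+ n.+1)%g }.

Lemma quasi_axisV g C : quasi_axis g C -> quasi_axis g^-1 C.
Proof.
move=> [st gr]; split=> [m n|n]; rewrite !expVgn.
  by rewrite gprodC invgK.
by rewrite !(lengthV hl).
Qed.

(** If l (g^2) exceeds l g by enough, the path x, g x, g^2 x backtracks at g x
by less than half the length of its edges, and gprod_step propagates this to
all powers. *)
Lemma quasi_axis_of_pow2 g : l g + 5 * d + 1 <= l (g ^+ 2)%g ->
  exists C, quasi_axis g C.
Proof.
move=> lg; have d0 := hyperbolicity_ge0.
pose A0 := gp g^-1 g.
have eA : 2 * A0 = 2 * l g - l (g ^+ 2)%g.
  by rewrite /A0 /gprod invgK (lengthV hl) expg2; lra.
have fwd n : gp g^-1 (g ^+ n)%g <= A0 + d.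
  elim: n => [|n IH].
    by have := gprod_leR g^-1 1; have := gprod_ge0 g^-1 g; rewrite (length1 hl) -/A0; lra.
  by rewrite expgS; apply: gprod_step IH _; [rewrite lexx|rewrite -/A0; lra].
have straight m n : gp (g ^- m)%g (g ^+ n)%g <= A0 + 2 * d.
  case: m => [|m].
    rewrite expg0 invg1; have := gprod_leL 1 (g ^+ n)%g.
    by have := gprod_ge0 g^-1 g; rewrite (length1 hl) -/A0; lra.
  rewrite expgSr invgM gprodC.
  have <- : A0 + d + d = A0 + 2 * d by lra.
  apply: (@gprod_step _ _ _ _ (A0 + d)); first by rewrite gprodC fwd.
    rewrite invgK; have := fwd m; rewrite /gprod invgK -expgS.
    by rewrite -invgM -expgSr !(lengthV hl); lra.
  by rewrite (lengthV hl); lra.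
exists (A0 + 2 * d); split => // n.
rewrite expgS lengthM_gprod; have := fwd n; lra.
Qed.

(** A power of g satisfies the hypothesis of quasi_axis_of_pow2: otherwise each
doubling of the exponent would add only a constant to the length, and
l (g^(2^k)) would grow linearly in k. *)
Lemma exists_quasi_axis g (u v : R) :
  0 < u -> (forall n : nat, u * n%:R - v <= l (g ^+ n)%g) ->
  exists m C, quasi_axis (g ^+ m)%g C.
Proof.
move=> u0 lin; apply: contrapT => nq.
have grow m : l (g ^+ m ^+ 2)%g <= l (g ^+ m)%g + (5 * d + 1).
  rewrite leNgt; apply/negP => lt; apply: nq; exists m.
  by apply: quasi_axis_of_pow2; lra.
have dbl k : l (g ^+ (2 ^ k))%g <= l g + k%:R * (5 * d + 1).
  elim: k => [|k IH]; first by rewrite expn0 expg1; lra.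
  have := grow (2 ^ k)%N; rewrite -expgnA expnS mulnC -natr1; lra.
have d0 := hyperbolicity_ge0.
(* The exponent 2 ^ (k + 2) is at least k ^ 2, so the lower bound for its length
   is quadratic in k while the upper bound is affine in k. *)
have sq k : (k ^ 2 <= 2 ^ k.+2)%N.
  elim: k => // k IH; rewrite expnS.
  case: k IH => [|[|[|k]]] // IH.
  apply: (@leq_trans (2 * k.+3 ^ 2)%N); last by rewrite leq_mul2l IH.
  by rewrite !expnS !expn0; nia.
pose w := 5 * d + 1; pose b := l g + v + 2 * w.
have key (k : nat) : u * k%:R ^+ 2 <= b + k%:R * w.
  have := lin (2 ^ k.+2)%N; have := dbl k.+2; rewrite -/w -2!natr1 => h1 h2.
  have : u * k%:R ^+ 2 <= u * (2 ^ k.+2)%:R.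
    by rewrite ler_pM2l // -natrX ler_nat sq.
  by rewrite /b; lra.
pose k := (Num.truncn ((`|b| + w + 1) / u)).+1.
have hk : `|b| + w + 1 < u * k%:R.
  by rewrite mulrC -ltr_pdivrMr //; apply: truncnS_gt.
have k1 : 1 <= k%:R :> R by rewrite ler1n.
have := key k; have := ler_norm b; have := normr_ge0 b; rewrite expr2; nra.
Qed.

Section Axis.
Variables (e : G) (C : R).
Hypothesis ax : quasi_axis e C.

Lemma axis_const_ge0 : 0 <= C.
Proof. exact: le_trans (gprod_ge0 _ _) (axis_straight ax 0 0). Qed.

Lemma axis_length_ge n : n%:R <= l (e ^+ n)%g.
Proof.
elim: n => [|n IH]; first exact: length_ge0.
by have := axis_growth ax n; rewrite -natr1; lra.
Qed.

Lemma axis_length_lt m n : (m < n)%N -> l (e ^+ m)%g < l (e ^+ n)%g.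
Proof.
elim: n => // n IH; rewrite ltnS leq_eqVlt => /predU1P[->|/IH];
  have := axis_growth ax n; lra.
Qed.

Lemma gprod_axis m n : (m <= n)%N -> l (e ^+ m)%g - C <= gp (e ^+ m)%g (e ^+ n)%g.
Proof.
move=> mn; rewrite -(subnKC mn) expgnDr gprod_mulr.
by have := axis_straight ax m (n - m); lra.
Qed.

Lemma axis_far (x : R) : exists n : nat, x <= l (e ^+ n)%g.
Proof.
exists (Num.truncn x).+1; apply: le_trans (axis_length_ge _).
exact/ltW/truncnS_gt.
Qed.

End Axis.

End HyperbolicLengths.

(** * Ends of the axis and small growth *)

Section Subgroups.
Variables (R : realType) (G : groupType) (l : G -> R) (d : R).
Hypothesis hl : hyperbolic_length l d.
Hypothesis acyl : acylindrical_length l.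
Implicit Types (a b e g p q t y z : G).

Local Notation gp := (gprod l).

(** The balls of a subgroup for a word length on an ambient group; the subgroup
is the union of the balls. *)
Record ball_system (B : nat -> {fset G}) : Prop := BallSystem {
  ball1 : 1%g \in B 0%N;
  ball_le : forall m n a, (m <= n)%N -> a \in B m -> a \in B n;
  ballM : forall m n a b, a \in B m -> b \in B n -> (a * b)%g \in B (m + n)%N;
  ballV : forall n a, a \in B n -> exists m, a^-1%g \in B m }.

Variables (B : nat -> {fset G}) (K : nat).
Hypothesis hB : ball_system B.
Hypothesis ball_length : forall n a, a \in B n -> l a <= K%:R * n%:R.

(** The translate by t of the ray e^n x does not converge to the same boundary
point as the ray itself. *)
Definition moves_end e t : Prop :=
  exists A, forall n, gp (e ^+ n)%g (t * e ^+ n)%g <= A.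

Section Axis.
Variables (e : G) (C : R).
Hypothesis ax : quasi_axis l e C.

(** Beyond the j-th point, the translated ray t e^n x moves straight away from
x: initially it may approach x, but only over a distance at most l t. *)
Lemma translated_axis_straight t j n :
  l t + C + d < l (e ^+ j)%g -> gp (t * e ^+ j)^-1%g (e ^+ n)%g <= C + d.
Proof.
move=> lj; rewrite invgM (gprodC hl) //.
apply: (gprod_step hl (C' := l t)).
- by rewrite (gprodC hl) //; exact: axis_straight.
- by rewrite invgK; have := gprod_leR hl (e ^+ j)%g t^-1%g; rewrite (lengthV hl).
- by rewrite (lengthV hl); lra.
Qed.

Lemma translated_axis_length t j n : l t + C + d < l (e ^+ j)%g ->
  l (t * e ^+ j)%g + l (e ^+ n)%g - 2 * (C + d) <= l (t * e ^+ (j + n))%g /\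
  l (t * e ^+ (j + n))%g <= l (t * e ^+ j)%g + l (e ^+ n)%g.
Proof.
move=> lj; rewrite expgnDr mulgA (lengthM_gprod hl (t * e ^+ j)%g).
have h1 := translated_axis_straight n lj.
by have h0 := gprod_ge0 hl (t * e ^+ j)^-1%g (e ^+ n)%g; split; lra.
Qed.

(** If t fixes the end of the ray, then far points of the ray e^n x are reached
from x by passing near t e^j x.  The points e^n0 x and t e^n0 x have a large
Gromov product, which connects the directions of t e^j x and e^n x. *)
Lemma fixed_end_converges t j : ~ moves_end e t ->
  l t + C + d < l (e ^+ j)%g ->
  exists n0, forall n, (n0 <= n)%N ->
    l (t * e ^+ j)%g - (C + 3 * d) <= gp (t * e ^+ j)%g (e ^+ n)%g.
Proof.
move=> fixe lj; have d0 := hyperbolicity_ge0 hl; have C0 := axis_const_ge0 hl ax.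
have [n0 hn0] : exists n0, l t + l (e ^+ j)%g < gp (e ^+ n0)%g (t * e ^+ n0)%g.
  apply: contrapT => H; apply: fixe; exists (l t + l (e ^+ j)%g) => n.
  by rewrite leNgt; apply/negP => ?; apply: H; exists n.
exists n0 => n n0n.
have tj := lengthM hl t (e ^+ j)%g.
have h1 := gprod_leL hl (e ^+ n0)%g (t * e ^+ n0)%g.
have jn0 : (j <= n0)%N.
  rewrite leqNgt; apply/negP => /(axis_length_lt ax).
  by have := length_ge0 hl t; lra.
have h2 : l (t * e ^+ j)%g - (C + d) <= gp (t * e ^+ j)%g (t * e ^+ n0)%g.
  rewrite -(subnKC jn0) expgnDr mulgA (gprod_mulr hl).
  by have := translated_axis_straight (n0 - j) lj; lra.
have h3 := gprod_axis hl ax n0n.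
case: (gprod_tri hl (t * e ^+ n0)%g (t * e ^+ j)%g (e ^+ n)%g); first lra.
case: (gprod_tri hl (e ^+ n0)%g (t * e ^+ n0)%g (e ^+ n)%g); last lra.
by rewrite (gprodC hl (t * e ^+ n0)%g (e ^+ n0)%g); lra.
Qed.

(** Suppose that all t in the balls fix the end of the axis, and choose j large
in terms of n.  For t in the n-ball, t e^j x and t e^(j+m) x lie nearly on the
way from x to the end, at distances from x determined up to a constant by
l (t e^j).  So two elements t0 and t with nearly the same l (t e^j) move both
points to nearly the same places, and (t0 e^j)^-1 t e^j is one of the boundedly
many elements given by acylindricity.  The values of l (t e^j) lie in an interval of
length 2 K n, which is cut into pieces of length 1. *)
Lemma moves_end_or_small_growth :
  (exists t, (exists n, t \in B n) /\ moves_end e t) \/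
  exists K', forall n, (#|` B n| <= K' * n.+1)%N.
Proof.
apply/or_asboolP; rewrite -implyNb; apply/implyP => /asboolPn nomove.
apply/asboolP.
have fixe t n : t \in B n -> ~ moves_end e t.
  by move=> tB mt; apply: nomove; exists t; split => //; exists n.
have d0 := hyperbolicity_ge0 hl; have C0 := axis_const_ge0 hl ax.
pose eps : R := 1 + 2 * (C + d) + 2 * (C + 3 * d) + 2 * d.
have eps0 : 0 < eps by rewrite /eps; lra.
have [r [N hN]] := acyl eps0.
(* far enough out for acylindricity to apply to the pair x, e ^ m x *)
have [m hm] := axis_far hl ax r.
exists (N * (2 * K).+1)%N => n.
have [j hj] := axis_far hl ax (K%:R * n%:R + C + d + 1).
have lB t : t \in B n -> l t + C + d < l (e ^+ j)%g.
  by move/ball_length; lra.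
pose cls t : 'I_(2 * K * n).+1 :=
  inord (Num.truncn (l (t * e ^+ j)%g - l (e ^+ j)%g + K%:R * n%:R)).
have rng t : t \in B n ->
    0 <= l (t * e ^+ j)%g - l (e ^+ j)%g + K%:R * n%:R <= 2 * K%:R * n%:R.
  move=> /ball_length lt; have := lengthM hl t (e ^+ j)%g.
  have := lengthM hl t^-1 (t * e ^+ j)%g; rewrite mulKg (lengthV hl).
  by move=> *; apply/andP; split; lra.
have clsE t t' : t \in B n -> t' \in B n -> cls t = cls t' ->
    l (t * e ^+ j)%g <= l (t' * e ^+ j)%g + 1.
  move=> tB t'B /(congr1 val); have /andP[a0 a1] := rng _ tB.
  have /andP[b0 b1] := rng _ t'B.
  have bd (x : R) : x <= 2 * K%:R * n%:R -> (Num.truncn x < (2 * K * n).+1)%N.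
    move=> xle; rewrite ltnS truncn_le_nat; apply: le_lt_trans xle _.
    by rewrite -!natrM ltr_nat.
  rewrite /= !inordK ?bd // => E.
  have /andP[_ x1] := truncn_itv a0; have /andP[y0 _] := truncn_itv b0.
  by move: x1 y0; rewrite E -natr1; lra.
have [B0|B0] := posnP #|` B n|; first by rewrite B0.
have [u hu] := pigeonhole cls B0.
apply: leq_trans hu _; rewrite card_ord.
set S := [fset _ in _ | _]%fset.
suff SN : (#|` S| <= N)%N.
  have cn : ((2 * K * n).+1 <= (2 * K).+1 * n.+1)%N by nia.
  by apply: leq_trans (leq_mul cn SN) _; lia.
have [->|/fset0Pn[t0 t0S]] := eqVneq S fset0; first by rewrite cardfs0.
move: (t0S); rewrite !inE => /andP[t0B /eqP t0u].
pose f t := ((t0 * e ^+ j)^-1 * (t * e ^+ j))%g.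
have finj : injective f by move=> t t' /mulgI/mulIg.
have <- : #|` (f @` S)%fset| = #|` S| by rewrite card_imfset.
apply: (hN (e ^+ m)%g) => // _ /imfsetP[t /= tS ->].
move: tS; rewrite !inE => /andP[tB /eqP tu].
have c1 := clsE _ _ tB t0B (etrans tu (esym t0u)).
have c2 := clsE _ _ t0B tB (etrans t0u (esym tu)).
have [m1 m2] := translated_axis_length m (lB _ tB).
have [m3 m4] := translated_axis_length m (lB _ t0B).
have lBm t' : t' \in B n -> l t' + C + d < l (e ^+ (j + m))%g.
  move=> /lB; case: m {hm m1 m2 m3 m4} => [|m]; first by rewrite addn0.
  have /(axis_length_lt ax) : (j < j + m.+1)%N by rewrite addnS ltnS leq_addr.
  by lra.
have [n1 h1] := fixed_end_converges (fixe _ _ tB) (lB _ tB).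
have [n2 h2] := fixed_end_converges (fixe _ _ tB) (lBm _ tB).
have [n3 h3] := fixed_end_converges (fixe _ _ t0B) (lB _ t0B).
have [n4 h4] := fixed_end_converges (fixe _ _ t0B) (lBm _ t0B).
pose M := maxn (maxn n1 n2) (maxn n3 n4).
have {h1}/h1 h1 : (n1 <= M)%N by rewrite !leq_max leqnn.
have {h2}/h2 h2 : (n2 <= M)%N by rewrite !leq_max leqnn orbT.
have {h3}/h3 h3 : (n3 <= M)%N by rewrite !leq_max leqnn !orbT.
have {h4}/h4 h4 : (n4 <= M)%N by rewrite !leq_max leqnn !orbT.
have -> : ((e ^+ m)^-1 * f t * e ^+ m = (t0 * e ^+ (j + m))^-1 * (t * e ^+ (j + m)))%g.
  by rewrite /f expgnDr !invgM !mulgA.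
split.
  by apply: le_trans (same_direction_close hl h3 h1 c2 c1) _; rewrite /eps; lra.
apply: le_trans (same_direction_close hl (w := 1 + 2 * (C + d)) h4 h2 _ _) _;
  rewrite /eps; lra.
Qed.

End Axis.

(** * Pivots *)

Section Pivots.
Variables (g : G) (C : R).
Hypothesis ax : quasi_axis l g C.

Let u (i : bool) n := if i then (g ^+ n)%g else (g ^- n)%g.

(** The two ends of the axis lie in different directions, so y misses at least
one of them, and then it misses every f pointing towards that end. *)
Lemma avoid_direction n y : exists i, forall f,
  C + 2 * d < gp f (u i n) -> gp y f <= C + 2 * d.
Proof.
have st : gp (u true n) (u false n) <= C by rewrite (gprodC hl); exact: axis_straight.
have [i yi] : exists i, gp y (u i n) <= C + d.
  case: (gprod_tri hl y (u true n) (u false n)) => h; [exists true|exists false].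
    by rewrite (gprodC hl); lra.
  by lra.
exists i => f fi; have := hyperbolicity_ge0 hl.
by case: (gprod_tri hl f y (u i n)); lra.
Qed.

(** If t moves w x to a different direction, then x, w^-1 x, w^-1 t x,
w^-1 t w x is nearly a geodesic; so the conjugate of t is long, and both it and
its inverse start in the direction of w^-1. *)
Lemma conjugate_directions t w A : gp w (t * w)%g <= A ->
  [/\ l w - A <= gp (w^-1 * (t * w))%g w^-1%g,
      l w - (A + l t) <= gp (w^-1 * (t * w))^-1%g w^-1%g &
      2 * l w - l t - 2 * A <= l (w^-1 * (t * w))%g].
Proof.
move=> gA.
have tw : l w - l t <= l (t * w)%g.
  by have := lengthM hl t^-1%g (t * w)%g; rewrite mulKg (lengthV hl); lra.
split.
- by rewrite (gprodC hl) (gprod_mulr hl) invgK (lengthV hl); lra.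
- have -> : ((w^-1 * (t * w))^-1 = w^-1 * (t^-1 * w))%g.
    by rewrite !invgM invgK mulgA.
  rewrite (gprodC hl) (gprod_mulr hl) invgK (lengthV hl).
  have : gp w (t^-1 * w)%g <= gp w (t * w)%g + l t.
    rewrite /gprod.
    have -> : l (w^-1 * (t^-1 * w))%g = l (w^-1 * (t * w))%g.
      by rewrite -(lengthV hl (w^-1 * (t * w))%g) !invgM invgK mulgA.
    have := lengthM hl t^-1%g w; rewrite (lengthV hl).
    by lra.
  by lra.
- by rewrite lengthVM_gprod; lra.
Qed.

(** The index of a pivot records towards which end it starts and towards which
end its inverse starts.  The bound A does not depend on the length L imposed on
the pivots, since the constants coming from s and t are absorbed by the choice
of a large power of g. *)
Lemma exists_pivots s t :
  (exists n, g \in B n) ->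
  (exists n, s \in B n) -> moves_end g s ->
  (exists n, t \in B n) -> moves_end g^-1%g t ->
  exists2 A : R, 0 <= A & forall L, exists F : bool * bool -> G,
    (forall i, L <= l (F i) /\ exists n, F i \in B n) /\
    forall y z, exists i, gp y (F i) <= A /\ gp (F i)^-1%g z <= A.
Proof.
move=> gB sB [As hs] tB [At ht].
have d0 := hyperbolicity_ge0 hl; have C0 := axis_const_ge0 hl ax.
exists (C + 2 * d) => [|L]; first lra.
have [n hn] := axis_far hl ax
  (`|L| + C + 2 * d + l s + l t + `|As| + `|At| + 1).
have := ler_norm L; have := ler_norm As; have := ler_norm At.
have := normr_ge0 L; have := normr_ge0 As; have := normr_ge0 At.
have := length_ge0 hl s; have := length_ge0 hl t => t0 s0 At0 As0 L0 At1 As1 L1.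
have M a b : (exists n, a \in B n) -> (exists n, b \in B n) ->
    exists n, (a * b)%g \in B n.
  by move=> [i ia] [j jb]; exists (i + j)%N; apply: (ballM hB).
have V a : (exists n, a \in B n) -> exists n, a^-1%g \in B n.
  by move=> [i /(ballV hB)].
have X : exists m, (g ^+ n)%g \in B m.
  elim: n {hn} => [|n IH]; first by exists 0%N; exact: (ball1 hB).
  by rewrite expgS; apply: M.
pose F (i : bool * bool) := match i with
  | (true, true) => (g ^+ n * (t * g ^- n))%g
  | (true, false) => (g ^+ n)%g
  | (false, true) => (g ^- n)%g
  | (false, false) => (g ^- n * (s * g ^+ n))%g
  end.
have pin (a : G) : gp a a = l a.
  by rewrite /gprod mulVg (length1 hl); lra.
have FP i : [/\ L <= l (F i), C + 2 * d < gp (F i) (u i.1 n) &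
                C + 2 * d < gp (F i)^-1%g (u i.2 n)].
  case: i => [[] []]; rewrite /F /u /=.
  - have := ht n; rewrite expVgn => /conjugate_directions.
    by rewrite invgK (lengthV hl) => -[? ? ?]; split; lra.
  - by rewrite !pin (lengthV hl); split; lra.
  - by rewrite invgK !pin (lengthV hl); split; lra.
  - by have [? ? ?] := conjugate_directions (hs n); split; lra.
exists F; split=> [i|y z].
  split; first by case: (FP i).
  by case: i => [[] []]; rewrite /F; auto.
have [i hi] := avoid_direction n y; have [j hj] := avoid_direction n z.
have [_ f1 f2] := FP (i, j); exists (i, j); split; first exact: hi.
by rewrite (gprodC hl); exact: hj.
Qed.

End Pivots.

(** * Products of blocks *)

Section FreeProducts.
Variables (S : {fset G}) (f : G) (A : R) (N : nat).

Fixpoint block_products k : {fset G} :=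
  if k is k'.+1 then
    [fset (u.1 * f * u.2)%g | u in (S `*` block_products k')%fset]%fset
  else [fset 1%g]%fset.

Hypothesis A0 : 0 <= A.
Hypothesis long : forall s, s \in S -> 2 * A + 2 * d < l s.
Hypothesis longf : 2 * A + 2 * d < l f.
Hypothesis break_sf : forall s, s \in S -> gp s^-1%g f <= A.
Hypothesis break_fs : forall s, s \in S -> gp f^-1%g s <= A.
Hypothesis same_length : forall s s', s \in S -> s' \in S -> l s <= l s' + 1.
(* acylindricity for the pair x, f x, with the error of block_products_decode *)
Hypothesis few : forall E : {fset G}, (forall h, h \in E ->
    l h <= 1 + 2 * A + 2 * (A + 2 * d) + 2 * d /\
    l (f^-1 * h * f)%g <= 1 + 2 * A + 2 * (A + 2 * d) + 2 * d) ->
  (#|` E| <= N)%N.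

Lemma block_break s q : s \in S -> gp f^-1%g q <= A + d ->
  gp s^-1%g (f * q)%g <= A + d.
Proof.
by move=> sS fq; apply: (gprod_step hl (break_sf sS) fq); have := longf; lra.
Qed.

Lemma block_products_straight k q : q \in block_products k ->
  gp f^-1%g q <= A + d.
Proof.
have d0 := hyperbolicity_ge0 hl.
elim: k q => [|k IH] q /=.
  rewrite inE => /eqP->; apply: le_trans (gprod_leR hl _ _) _.
  by rewrite (length1 hl) addr_ge0.
case/imfsetP => -[s q'] /=; rewrite in_fsetM => /andP[/= sS /IH fq] ->.
rewrite -mulgA; apply: (gprod_step hl (break_fs sS) (block_break sS fq)).
by have := long sS; lra.
Qed.

(** Both s x and s' x lie nearly on the way from x to the product, at nearly the
same distance; so do s f x and s' f x. *)
Lemma block_products_decode s s' q q' : s \in S -> s' \in S ->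
  gp f^-1%g q <= A + d -> gp f^-1%g q' <= A + d ->
  (s * f * q = s' * f * q')%g ->
  l (s^-1 * s')%g <= 1 + 2 * A + 2 * (A + 2 * d) + 2 * d /\
  l (f^-1 * (s^-1 * s') * f)%g <= 1 + 2 * A + 2 * (A + 2 * d) + 2 * d.
Proof.
move=> sS s'S fq fq' E; have d0 := hyperbolicity_ge0 hl.
have far_s x r : x \in S -> gp f^-1%g r <= A + d ->
    l x - (A + d) <= gp x (x * f * r)%g.
  move=> xS fr; rewrite -mulgA (gprod_mulr hl).
  by have := block_break xS fr; lra.
have far_sf x r : x \in S -> gp f^-1%g r <= A + d ->
    l (x * f)%g - (A + 2 * d) <= gp (x * f)%g (x * f * r)%g.
  move=> xS fr; rewrite (gprod_mulr hl) invgM (gprodC hl).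
  suff : gp r (f^-1 * x^-1)%g <= A + d + d by lra.
  apply: (gprod_step hl (C' := A)); first by rewrite (gprodC hl).
    by rewrite invgK (gprodC hl) break_sf.
  by rewrite (lengthV hl); have := longf; lra.
have len x : x \in S -> l x + l f - 2 * A <= l (x * f)%g /\ l (x * f)%g <= l x + l f.
  move=> xS; rewrite (lengthM_gprod hl); have := break_sf xS.
  by have := gprod_ge0 hl x^-1%g f; split; lra.
have := same_length sS s'S; have := same_length s'S sS => l1 l2.
have [a1 a2] := len _ sS; have [b1 b2] := len _ s'S.
split.
  have h := far_s _ _ s'S fq'; rewrite -E in h.
  by apply: le_trans (same_direction_close hl (far_s _ _ sS fq) h l2 l1) _; lra.
have -> : (f^-1 * (s^-1 * s') * f = (s * f)^-1 * (s' * f))%g.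
  by rewrite invgM !mulgA.
have h := far_sf _ _ s'S fq'; rewrite -E in h.
by apply: (same_direction_close hl (far_sf _ _ sS fq) h); lra.
Qed.

(** A pair (s, q) with given product is determined by s, for which there are at
most N possibilities; this bounds the number of products recursively. *)
Lemma card_block_products k :
  (#|` S| ^ k <= N ^ k * #|` block_products k|)%N.
Proof.
elim: k => [|k IH]; first by rewrite cardfs1.
have step : (#|` S| * #|` block_products k| <= N * #|` block_products k.+1|)%N.
  rewrite -card_pairs /=; apply: card_fibers_le => -[s q].
  rewrite in_fsetM => /andP[/= sS /block_products_straight fq].
  set E := [fset _ in _ | _]%fset.
  pose h (v : G * G) := (s^-1 * v.1)%g.
  have <- : #|` (h @` E)%fset| = #|` E|.
    apply: card_in_imfset => -[s1 q1] [s2 q2].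
    rewrite !inE /= => /andP[_ /eqP E1] /andP[_ /eqP E2] /mulgI /= e12.
    by move: E1; rewrite e12 -E2 => /mulgI ->.
  apply: few => _ /imfsetP[[s' q'] /= + ->].
  rewrite !inE /= => /andP[/andP[s'S /block_products_straight fq'] /eqP e].
  exact: block_products_decode s'S fq fq' (esym e).
rewrite !expnS; apply: leq_trans (leq_mul (leqnn _) IH) _.
by rewrite mulnCA -[leqRHS]mulnA [leqRHS]mulnCA leq_mul2l step orbT.
Qed.

End FreeProducts.

(** * Supermultiplicativity of the growth *)

Lemma affine_bound (a b n : nat) :
  ((a * (n + b)).+1 <= (a * b + a).+1 * n.+1)%N.
Proof. by clear; nia. Qed.

Lemma small_growth_supermultiplicative k :
  (forall n, (#|` B n| <= k * n.+1)%N) ->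
  supermultiplicative_up_to (fun n => #|` B n|) 0 k.
Proof.
move=> small n m; rewrite -[leqLHS]muln1 leq_mul //.
  by case: m => // m; rewrite leq_exp2r.
rewrite cardfs_gt0; apply/fset0Pn; exists 1%g.
exact: (ball_le hB (leq0n _) (ball1 hB)).
Qed.

(** An element too short to be a block becomes long after multiplication by the
long element w.  The n-ball is sorted by whether w is used, by the pivot
suitable for both sides of the block, and by the integer part of the length of
the block; a class of at least average size yields S. *)
Lemma moving_ends_supermultiplicative g C s t :
  quasi_axis l g C ->
  (exists n, g \in B n) ->
  (exists n, s \in B n) -> moves_end g s ->
  (exists n, t \in B n) -> moves_end g^-1%g t ->
  exists c k, supermultiplicative_up_to (fun n => #|` B n|) c k.
Proof.
move=> ax gB sB gs tB gt; have d0 := hyperbolicity_ge0 hl.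
have [A A0 pivots] := exists_pivots ax gB sB gs tB gt.
pose eps : R := 1 + 2 * A + 2 * (A + 2 * d) + 2 * d.
have eps0 : 0 < eps by rewrite /eps; lra.
have [r [N hN]] := acyl eps0.
pose L : R := 2 * A + 2 * d + 1.
have [F [FL FA]] := pivots (L + `|r|).
have [w wL wB] : exists2 w, 2 * L <= l w & exists n, w \in B n.
  have [n hn] := axis_far hl ax (2 * L); exists (g ^+ n)%g => //.
  elim: n {hn} => [|n [i IH]]; first by exists 0%N; exact: (ball1 hB).
  by case: gB => j gj; exists (j + i)%N; rewrite expgS; apply: (ballM hB).
have [c [wc Fc]] : exists c, w \in B c /\ forall i, F i \in B c.
  have [i wi] := wB.
  have /choice[n hn] : forall j, exists n, F j \in B n by move=> j; case: (FL j).
  exists (i + \max_j n j)%N; split; first exact: (ball_le hB (leq_addr _ _) wi).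
  move=> j; apply: (ball_le hB _ (hn j)).
  exact: leq_trans (bigop.leq_bigmax j) (leq_addl _ _).
pose v (b : bool) := if b then w else 1%g.
have vc (b : bool) : v b \in B c.
  by case: b; [exact: wc|exact: (ball_le hB (leq0n _) (ball1 hB))].
have /choice[p hp] : forall h, exists b : bool, L <= l (h * v b)%g.
  move=> h; case: (leP L (l h)) => hL; first by exists false; rewrite mulg1.
  exists true; have := lengthM hl h^-1%g (h * w)%g.
  by rewrite mulKg (lengthV hl) /=; lra.
have /choice[i hi] : forall h, exists i,
    gp (h * v (p h))^-1%g (F i) <= A /\ gp (F i)^-1%g (h * v (p h))%g <= A.
  by move=> h; apply: FA.
exists (2 * c)%N, (8 * (K * c + K).+1 * N)%N => n m.
pose e h : 'I_(K * (n + c)).+1 := inord (Num.truncn (l (h * v (p h))%g)).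
have [|[[p0 i0] e0]] := pigeonhole (fun h => (p h, i h, e h)) (A := B n).
  rewrite cardfs_gt0; apply/fset0Pn; exists 1%g.
  exact: (ball_le hB (leq0n _) (ball1 hB)).
set S0 := [fset _ in _ | _]%fset.
rewrite !card_prod card_bool card_ord => cardS.
have S0P h : h \in S0 -> [/\ h \in B n, p h = p0, i h = i0 & e h = e0].
  by rewrite !inE => /andP[hB' /eqP[-> -> ->]].
pose S := [fset (h * v p0)%g | h in S0]%fset.
have SS0 : #|` S| = #|` S0| by rewrite card_imfset //; exact: mulIg.
have SP x : x \in S -> [/\ x \in B (n + c)%N, L <= l x, gp x^-1%g (F i0) <= A,
    gp (F i0)^-1%g x <= A & Num.truncn (l x) = e0].
  move=> /imfsetP[h /= /S0P[hn hp0 hi0 he0] ->].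
  have xB : (h * v p0)%g \in B (n + c)%N by exact: (ballM hB).
  have := hi h; have := hp h; rewrite hp0 hi0 => h1 [h2 h3]; split=> //.
  rewrite -he0 /e inordK hp0 // ltnS truncn_le_nat.
  apply: le_lt_trans (ball_length xB) _.
  by rewrite -natrM ltr_nat.
have same x y : x \in S -> y \in S -> l x <= l y + 1.
  move=> /SP[_ _ _ _ ex] /SP[_ _ _ _ ey].
  have /andP[_ hx] := truncn_itv (length_ge0 hl x).
  have /andP[hy _] := truncn_itv (length_ge0 hl y).
  by move: hx hy; rewrite ex ey -natr1; lra.
have [Fi0 _] := FL i0.
have L0 : 0 <= L by rewrite /L; lra.
have rF : r <= l (F i0) by have := ler_norm r; lra.
have LF : 2 * A + 2 * d < l (F i0) by have := normr_ge0 r; move: Fi0; rewrite /L; lra.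
have longS x : x \in S -> 2 * A + 2 * d < l x by case/SP=> _; rewrite /L; lra.
have sf x : x \in S -> gp x^-1%g (F i0) <= A by case/SP.
have fs x : x \in S -> gp (F i0)^-1%g x <= A by case/SP.
have := card_block_products A0 longS LF sf fs same (hN _ rF) m.
set P := block_products S (F i0); rewrite SS0 => count.
have PB j q : q \in P j -> q \in B (j * (n + 2 * c))%N.
  elim: j q => [|j IH] q /=; first by rewrite inE => /eqP->; exact: (ball1 hB).
  case/imfsetP => -[x q'] /=; rewrite in_fsetM => /andP[/= /SP[xB _ _ _ _]].
  move=> /IH qB ->; rewrite mulSn; apply: (ballM hB _ qB).
  by rewrite mul2n -addnn addnA; exact: (ballM hB xB (Fc i0)).
have PBm : (#|` P m| <= #|` B (m * (n + 2 * c))|)%N.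
  by apply/fsubset_leq_card/fsubsetP => q /PB.
apply: (@leq_trans ((8 * (K * (n + c)).+1) ^ m * #|` S0| ^ m)%N).
  by rewrite -expnMn; case: m {count PBm} => // m; rewrite leq_exp2r.
apply: (@leq_trans ((8 * (K * (n + c)).+1) ^ m * (N ^ m * #|` P m|))%N).
  by rewrite leq_mul2l count orbT.
rewrite mulnA -expnMn leq_mul //; case: m {count PBm} => // m.
rewrite leq_exp2r // [leqRHS]mulnAC -[X in (_ <= X * _)%N]mulnA.
by rewrite leq_mul // leq_mul // affine_bound.
Qed.

Lemma growth_supermultiplicative g (x y : R) :
  (exists n, g \in B n) ->
  0 < x -> (forall n : nat, x * n%:R - y <= l (g ^+ n)%g) ->
  exists c k, supermultiplicative_up_to (fun n => #|` B n|) c k.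
Proof.
move=> [i gi] x0 lin; have [m [C ax]] := exists_quasi_axis hl x0 lin.
have gmB : exists n, (g ^+ m)%g \in B n.
  elim: m {ax} => [|m [j IH]]; first by exists 0%N; exact: (ball1 hB).
  by exists (i + j)%N; rewrite expgS; apply: (ballM hB).
have [[s [sB ms]]|[k hk]] := moves_end_or_small_growth ax; last first.
  by exists 0%N, k; exact: small_growth_supermultiplicative.
have [[t [tB mt]]|[k hk]] := moves_end_or_small_growth (quasi_axisV hl ax); last first.
  by exists 0%N, k; exact: small_growth_supermultiplicative.
exact: moving_ends_supermultiplicative ax gmB sB ms tB mt.
Qed.

End Subgroups.

(** * Balls for word lengths *)

Section WordBalls.
Variables (G : groupType) (X : set G).
Hypothesis Xgen : finite_generating_set X.
Implicit Types (a b g h : G) (n m : nat).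

Lemma word_lengthP g : represented_by_word X g (word_length X g) /\
  forall m, represented_by_word X g m -> (word_length X g <= m)%N.
Proof.
apply: (@xgetPex _ 0%N [set n | represented_by_word X g n /\
  forall m, represented_by_word X g m -> (n <= m)%N]).
have [n gn] := Xgen.2 g.
have ex : exists m, `[< represented_by_word X g m >] by exists n; apply/asboolP.
have [m /asboolP gm min_m] := ex_minnP ex.
by exists m; split=> // j gj; apply: min_m; apply/asboolP.
Qed.

Lemma word_length1 : word_length X 1%g = 0%N.
Proof.
apply/eqP; rewrite -leqn0; apply: (word_lengthP _).2.
by exists [::]; rewrite big_nil; split.
Qed.

Lemma word_lengthM a b :
  (word_length X (a * b)%g <= word_length X a + word_length X b)%N.
Proof.
have [[u [uX su ua]] _] := word_lengthP a.
have [[v [vX sv vb]] _] := word_lengthP b.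
apply: (word_lengthP _).2; exists (u ++ v); split.
- by move=> x; rewrite mem_cat => /orP[/uX|/vX].
- by rewrite size_cat su sv.
- by rewrite big_cat /= ua vb.
Qed.

(** The identity is a letter so that words of length n represent all elements of
word length at most n. *)
Definition letters : {fset G} :=
  let X' := fset_set X in (1%g |` X' `|` [fset x^-1%g | x in X'])%fset.

Lemma mem_letters x : X x \/ X x^-1%g -> x \in letters.
Proof.
have inX y : X y -> y \in fset_set X.
  by move=> Xy; rewrite (in_fset_set Xgen.1); apply: mem_set.
rewrite /letters !in_fsetU => -[/inX ->|/inX xX]; first by rewrite orbT.
by apply/orP; right; apply/imfsetP; exists x^-1%g; rewrite ?invgK.
Qed.

Fixpoint words n : {fset G} :=
  if n is n'.+1 then
    [fset (u.1 * u.2)%g | u in (letters `*` words n')%fset]%fset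
  else [fset 1%g]%fset.

Lemma card_words n : (#|` words n| <= #|` letters| ^ n)%N.
Proof.
elim: n => [|n IH] /=; first by rewrite cardfs1.
rewrite expnS; apply: leq_trans (leq_imfset_card _ _ _) _.
by rewrite card_pairs leq_mul.
Qed.

Lemma mem_words g n : (word_length X g <= n)%N -> g \in words n.
Proof.
have [[w [wX <- <-]] _] := word_lengthP g.
elim: n w wX => [|n IH] w wX.
  by rewrite leqn0 size_eq0 => /eqP->; rewrite big_nil /= inE.
case: w wX => [_ _|x w wX] /=.
  apply/imfsetP; exists (1%g, 1%g); last by rewrite big_nil mulg1.
  rewrite /= in_fsetM /= {1}/letters !inE eqxx /=.
  by have := IH [::] (fun x => ltac:(by [])) isT; rewrite big_nil.
rewrite ltnS big_cons => /IH IHw.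
apply/imfsetP; exists (x, (\prod_(y <- w) y)%g) => //=.
rewrite in_fsetM /= mem_letters ?IHw //.
- by move=> y yw; apply: wX; rewrite inE yw orbT.
- by apply: wX; rewrite inE eqxx.
Qed.

Lemma linear_in_word_length (R : realType) (l : G -> R) :
  l 1%g = 0 -> (forall a b, l (a * b)%g <= l a + l b) ->
  exists K : nat, forall g, l g <= K%:R * (word_length X g)%:R.
Proof.
move=> l1 lM; exists (\sum_(y <- letters) (Num.truncn (l y)).+1)%N => g.
set K := (\sum_(y <- _) _)%N.
have lK y : y \in letters -> l y <= K%:R.
  move=> yX; apply: le_trans (ltW (truncnS_gt _)) _; rewrite ler_nat.
  by rewrite /K (big_fsetD1 y) //= leq_addr.
have [[w [wX <- <-]] _] := word_lengthP g.
elim: w wX => [|x w IH] wX; first by rewrite big_nil l1 mulr0.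
rewrite big_cons /= -natr1 mulrDr mulr1 addrC; apply: le_trans (lM _ _) _.
apply: lerD; first by apply/lK/mem_letters/wX; rewrite inE eqxx.
by apply: IH => y yw; apply: wX; rewrite inE yw orbT.
Qed.

Variable H : set G.
Hypothesis subH : subgroup H.

Let ball n := fset_set (relative_ball X H n).

Lemma mem_relative_ball n h :
  h \in ball n <-> H h /\ (word_length X h <= n)%N.
Proof.
rewrite in_fset_set; first by split=> [/set_mem|/mem_set].
apply: sub_finite_set (finite_fset (words n)) => g [_].
exact: mem_words.
Qed.

Lemma card_relative_ball n : (relative_growth X H n <= #|` letters| ^ n)%N.
Proof.
apply: leq_trans (card_words n); apply: fsubset_leq_card.
by apply/fsubsetP => h /mem_relative_ball[_ /mem_words].
Qed.

Lemma relative_ball_system : ball_system ball.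
Proof.
have H1 : H 1%g by exact: set_mem subH.1.
have HV a : H a -> H a^-1%g.
  by move=> Ha; exact: set_mem (group_closedV subH (mem_set Ha)).
have HM a b : H a -> H b -> H (a * b)%g.
  by move=> Ha Hb; exact: set_mem (group_closedM subH (mem_set Ha) (mem_set Hb)).
split.
- by apply/mem_relative_ball; rewrite word_length1.
- move=> m n a mn /mem_relative_ball[Ha am]; apply/mem_relative_ball.
  by split=> //; apply: leq_trans mn.
- move=> m n a b /mem_relative_ball[Ha am] /mem_relative_ball[Hb bn].
  apply/mem_relative_ball; split; first exact: HM.
  by apply: leq_trans (word_lengthM a b) _; rewrite leq_add.
- move=> n a /mem_relative_ball[Ha _]; exists (word_length X a^-1%g).
  by apply/mem_relative_ball; split => //; exact: HV.
Qed.

End WordBalls.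

(** * Displacement of a basepoint *)

Section Displacement.
Variables (R : realType) (G : groupType) (T : metricType R) (a : G -> T -> T).
Hypothesis isom : isometric_action a.

Definition displacement (x : T) (g : G) : R := mdist x (a g x).

Lemma mdist_translates x g h :
  mdist (a g x) (a h x) = displacement x (g^-1 * h)%g.
Proof.
have [a1 aM ai] := isom.
by rewrite /displacement -(ai g^-1%g (a g x)) -!aM mulVg a1.
Qed.

Lemma gprod_displacement x g h :
  gprod (displacement x) g h = gromov_product x (a g x) (a h x).
Proof.
by rewrite /gprod /gromov_product mdist_translates /displacement
   (metric_sym x (a g x)) (metric_sym x (a h x)).
Qed.

Lemma displacement_hyperbolic x : gromov_hyperbolic T ->
  exists d, hyperbolic_length (displacement x) d.
Proof.
have [a1 aM ai] := isom => -[d hd]; exists d; split.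
- by rewrite /displacement a1 mdistxx.
- by move=> g; rewrite -[g^-1%g]mulg1 -mdist_translates a1 metric_sym.
- move=> g h; rewrite /displacement aM.
  by apply: le_trans (metric_triangle _ (a g x) _) _; rewrite ai.
- by move=> g h k; rewrite !gprod_displacement; apply: hd.
Qed.

Lemma displacement_acylindrical x :
  acylindrical a -> acylindrical_length (displacement x).
Proof.
have [a1 aM ai] := isom => acyl eps /acyl[r [N [_ _ hN]]].
exists r, N => b rb A hA.
rewrite -(set_fsetK A); apply: geq_card_fset_set.
apply: card_le_trans (hN x (a b x) rb).
apply: subset_card_le => h /hA[h1 h2]; split => //.
by rewrite -aM mdist_translates mulgA.
Qed.

End Displacement.

(** * Existence of the relative growth rate *)

Theorem theorem1p2 (R : realType) (G : groupType) (H : set G) :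
  finitely_generated G -> acylindrically_hyperbolic R G ->
  subgroup H ->
  (exists h : G, H h /\ generalized_loxodromic R h) ->
  forall X : set G, finite_generating_set X ->
    relative_growth_rate_exists R X H.
Proof.
move=> _ _ subH [g [Hg [T [a [[[_ _ hypT] isom acyl] [x lox]]]]]] X Xgen.
have [d hl] := displacement_hyperbolic isom x hypT.
have al := displacement_acylindrical isom x acyl.
have [K hK] := linear_in_word_length Xgen (length1 hl) (lengthM hl).
have bs := relative_ball_system Xgen subH.
have memB := mem_relative_ball Xgen H.
have [L [C [L1 _ qi]]] := lox.
have bK n h : h \in fset_set (relative_ball X H n) ->
    displacement a x h <= K%:R * n%:R.
  move=> /memB[_ hn]; apply: le_trans (hK h) _.
  by rewrite ler_wpM2l // ler_nat.
have lin (n : nat) : L^-1 * n%:R - C <= displacement a x (g ^+ n)%g.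
  have [+ _] := qi 0 n%:Z; rewrite sub0r normrN /= expg0.
  have [a1 _ _] := isom; rewrite a1 => h; exact: h.
have gB : exists n, g \in fset_set (relative_ball X H n).
  by exists (word_length X g); apply/memB.
have L0 : 0 < L^-1 by rewrite invr_gt0; lra.
have [c [k sup]] := growth_supermultiplicative hl al bs bK gB L0 lin.
apply: (root_cvg_of_supermultiplicative (c := c) (k := k)
          (a := #|` letters X|)) => //.
- move=> n; rewrite cardfs_gt0; apply/fset0Pn; exists 1%g.
  exact: (ball_le bs (leq0n _) (ball1 bs)).
- move=> m n mn; apply/fsubset_leq_card/fsubsetP => h.
  exact: (ball_le bs mn).
- exact: card_relative_ball.
Qed.
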